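(* Let $Y$ and $X$ be locally finite preordered sets, $R$ a $T$-algebra, $K'=I(Y,R)$, $K=I(X,R)$, and suppose that $K'$ and $K$ satisfy Condition (II) (for the pair). Then every algebra isomorphism $\varphi:K'\to K$ is a composition $\varphi=\nu\gamma$, where $\gamma:K'\to K$ is a diagonal isomorphism and $\nu$ is an inner automorphism of the algebra $K$.
   Context: Rings are associative with nonzero identity; $T$ is a commutative ring and algebra isomorphisms are $T$-algebra isomorphisms. A preordered set (reflexive, transitive relation) $X$ is locally finite if every interval $\{z:x\le z\le y\}$ is finite. Write $x\sim y$ iff $x\le y$ and $y\le x$; $[x]$ is the $\sim$-class of $x$. $I(X,R)$ is the $T$-algebra of functions $f:X\times X\to R$ with $f(x,y)=0$ if $x\not\le y$, with pointwise addition and $T$-action and product $(fg)(x,y)=\sum_{x\le z\le y}f(x,z)g(z,y)$. For $K=I(X,R)$: $L=\{f\in K:f(x,y)=0\text{ if }x\not\sim y\}$ (a subalgebra), $M=\{f\in K:f(x,y)=0\text{ if }x\sim y\}$ (an ideal), $K=L\oplus M$; $e_x\in L$ is the idempotent with $e_x(t,t)=1$ for $t\in[x]$ and other values $0$. For $K'=I(Y,R)$ the analogous objects are $L_1$, $M_1$, $f_y$, with $K'=L_1\oplus M_1$. An isomorphism $\gamma:K'\to K$ is diagonal if $\gamma(L_1)\subseteq L$ and $\gamma(M_1)\subseteq M$. An inner automorphism is one of the form $a\mapsto v^{-1}av$, $v$ invertible. Condition (II) for the pair $K',K$: for every algebra isomorphism $\varphi:K'\to K$ and every $x\in X$ there is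 $y\in Y$ with $\varphi^{-1}(e_x)\in f_y+M_1$. *)

(* Defs.v *)
From HB Require Import structures.
From mathcomp Require Import all_boot all_order all_algebra.
From mathcomp Require Import boolp classical_sets functions cardinality fsbigop.

Set Implicit Arguments.
Unset Strict Implicit.
Unset Printing Implicit Defensive.

Import Order.TTheory GRing.Theory.
Local Open Scope classical_set_scope.
Local Open Scope ring_scope.

Definition cinterval (d : Order.disp_t) (X : preorderType d) (x y : X) : set X :=
  [set z | (x <= z)%O && (z <= y)%O].

HB.mixin Record Preorder_isLocallyFinite (d : Order.disp_t) X
    of Order.Preorder d X := {
  cinterval_finite : forall x y : X, finite_set (cinterval x y)
}.

#[short(type="lfPreorderType")]
HB.structure Definition LFPreorder (d : Order.disp_t) :=
  { X of Order.Preorder d X & Preorder_isLocallyFinite d X }.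

Definition simeq (d : Order.disp_t) (X : preorderType d) (x y : X) : bool :=
  (x <= y)%O && (y <= x)%O.

Record incidence (T : comNzRingType) (R : algType T) (d : Order.disp_t)
    (X : lfPreorderType d) : Type := Incidence {
  incfun :> X -> X -> R;
  incfunP : forall x y, ~~ (x <= y)%O -> incfun x y = 0
}.

Arguments incidence {T} R {d} X.

(* I(X, R) is only a possibly trivial ring: it is zero when X is empty, so it
   has no [algType] structure in general.  The ring and T-module structures are
   given separately; [inc_scalerAl] and [inc_scalerAr] are the algebra axioms. *)
Section IncidenceAlgebra.
Context {T : comNzRingType} {R : algType T} {d : Order.disp_t}
  {X : lfPreorderType d}.
Implicit Types (f g h : incidence R X) (x y z : X) (a b : T).

HB.instance Definition _ := gen_eqMixin (incidence R X).
HB.instance Definition _ := gen_choiceMixin (incidence R X).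

Lemma incP f g : (forall x y, f x y = g x y) -> f = g.
Proof.
case: f => f fP; case: g => g gP /= fg.
have efg : f = g by apply/funext => x; apply/funext => y.
by rewrite efg in fP *; rewrite (Prop_irrelevance fP gP).
Qed.

Lemma inc_zero_subproof x y : ~~ (x <= y)%O -> (0 : R) = 0.
Proof. by []. Qed.

Definition inc_zero : incidence R X := Incidence inc_zero_subproof.

Lemma inc_opp_subproof f x y : ~~ (x <= y)%O -> - f x y = 0.
Proof. by move=> xy; rewrite incfunP ?oppr0. Qed.

Definition inc_opp f : incidence R X := Incidence (@inc_opp_subproof f).

Lemma inc_add_subproof f g x y : ~~ (x <= y)%O -> f x y + g x y = 0.
Proof. by move=> xy; rewrite !incfunP ?addr0. Qed.

Definition inc_add f g : incidence R X := Incidence (@inc_add_subproof f g).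

Lemma inc_scale_subproof a f x y : ~~ (x <= y)%O -> a *: f x y = 0.
Proof. by move=> xy; rewrite incfunP ?scaler0. Qed.

Definition inc_scale a f : incidence R X := Incidence (@inc_scale_subproof a f).

Lemma inc_one_subproof x y : ~~ (x <= y)%O -> (if x == y then 1 else 0 : R) = 0.
Proof. by case: eqP => // ->; rewrite lexx. Qed.

Definition inc_one : incidence R X := Incidence inc_one_subproof.

Lemma inc_mul_subproof f g x y : ~~ (x <= y)%O ->
  \sum_(z \in cinterval x y) (f x z * g z y) = 0.
Proof.
move=> xy; apply: fsbig1 => z /andP[xz zy].
by rewrite (le_trans xz zy) in xy.
Qed.

Definition inc_mul f g : incidence R X := Incidence (@inc_mul_subproof f g).

Lemma inc_addA : associative inc_add.
Proof. by move=> f g h; apply: incP => x y /=; rewrite addrA. Qed.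

Lemma inc_addC : commutative inc_add.
Proof. by move=> f g; apply: incP => x y /=; rewrite addrC. Qed.

Lemma inc_add0 : left_id inc_zero inc_add.
Proof. by move=> f; apply: incP => x y /=; rewrite add0r. Qed.

Lemma inc_addN : left_inverse inc_zero inc_opp inc_add.
Proof. by move=> f; apply: incP => x y /=; rewrite addNr. Qed.

HB.instance Definition _ :=
  GRing.isZmodule.Build (incidence R X) inc_addA inc_addC inc_add0 inc_addN.

Lemma inc_mul_widenr f g x y w : cinterval x y w ->
  \sum_(z \in cinterval x w) (f x z * g z w) =
  \sum_(z \in cinterval x y) (f x z * g z w).
Proof.
move=> /andP[xw wy]; apply: fsbig_widen => [z /andP[xz zw]|z [/andP[xz zy]]].
  by rewrite /cinterval/= xz (le_trans zw wy).
move=> nz; rewrite /= (incfunP g) ?mulr0//.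
by apply/negP => zw; apply: nz; rewrite /cinterval/= xz zw.
Qed.

Lemma inc_mul_widenl f g x y w : cinterval x y w ->
  \sum_(z \in cinterval w y) (f w z * g z y) =
  \sum_(z \in cinterval x y) (f w z * g z y).
Proof.
move=> /andP[xw wy]; apply: fsbig_widen => [z /andP[wz zy]|z [/andP[xz zy]]].
  by rewrite /cinterval/= zy (le_trans xw wz).
move=> nz; rewrite /= (incfunP f) ?mul0r//.
by apply/negP => wz; apply: nz; rewrite /cinterval/= wz zy.
Qed.

Lemma inc_mulA : associative inc_mul.
Proof.
move=> f g h; apply: incP => x y /=.
have fin := cinterval_finite x y.
transitivity (\sum_(z \in cinterval x y) \sum_(w \in cinterval x y)
   (f x z * g z w * h w y)).
  apply: eq_fsbigr => z /set_mem zxy.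
  rewrite (inc_mul_widenl g h zxy) !fsbig_finite//= mulr_sumr.
  by apply: eq_bigr => w _; rewrite mulrA.
rewrite exchange_fsbig//; apply: eq_fsbigr => w /set_mem wxy.
rewrite (inc_mul_widenr f g wxy) !fsbig_finite//= mulr_suml.
by apply: eq_bigr.
Qed.

Lemma inc_mul1 : left_id inc_one inc_mul.
Proof.
move=> f; apply: incP => x y /=.
have [xy|xy] := boolP (x <= y)%O; last by rewrite (incfunP f xy) (inc_mul_subproof inc_one f xy).
rewrite -(@fsbig_widen _ _ _ _ [set x]).
- by rewrite fsbig_set1 eqxx mul1r.
- by move=> _ ->; rewrite /cinterval/= lexx xy.
- by move=> z [_ /= /nesym/eqP/negbTE ->]; rewrite mul0r.
Qed.

Lemma inc_mulr1 : right_id inc_one inc_mul.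
Proof.
move=> f; apply: incP => x y /=.
have [xy|xy] := boolP (x <= y)%O; last by rewrite (incfunP f xy) (inc_mul_subproof f inc_one xy).
rewrite -(@fsbig_widen _ _ _ _ [set y]).
- by rewrite fsbig_set1 eqxx mulr1.
- by move=> _ ->; rewrite /cinterval/= lexx xy.
- by move=> z [_ /= /eqP/negbTE ->]; rewrite mulr0.
Qed.

Lemma inc_mulDl : left_distributive inc_mul inc_add.
Proof.
move=> f g h; apply: incP => x y /=; have fin := cinterval_finite x y.
rewrite !fsbig_finite//= -big_split/=.
by apply: eq_bigr => z _; rewrite mulrDl.
Qed.

Lemma inc_mulDr : right_distributive inc_mul inc_add.
Proof.
move=> f g h; apply: incP => x y /=; have fin := cinterval_finite x y.
rewrite !fsbig_finite//= -big_split/=.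
by apply: eq_bigr => z _; rewrite mulrDr.
Qed.

HB.instance Definition _ := GRing.Zmodule_isPzRing.Build (incidence R X)
  inc_mulA inc_mul1 inc_mulr1 inc_mulDl inc_mulDr.

Lemma inc_scaleA a b f : inc_scale a (inc_scale b f) = inc_scale (a * b) f.
Proof. by apply: incP => x y /=; rewrite scalerA. Qed.

Lemma inc_scale1 : left_id 1 inc_scale.
Proof. by move=> f; apply: incP => x y /=; rewrite scale1r. Qed.

Lemma inc_scaleDr : right_distributive inc_scale +%R.
Proof. by move=> a f g; apply: incP => x y /=; rewrite scalerDr. Qed.

Lemma inc_scaleDl f : {morph inc_scale^~ f : a b / a + b}.
Proof. by move=> a b; apply: incP => x y /=; rewrite scalerDl. Qed.

HB.instance Definition _ := GRing.Zmodule_isLmodule.Build T (incidence R X)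
  inc_scaleA inc_scale1 inc_scaleDr inc_scaleDl.

Lemma inc_scalerAl a f g : a *: (f * g) = (a *: f) * g.
Proof.
apply: incP => x y /=; have fin := cinterval_finite x y.
by rewrite !fsbig_finite//= scaler_sumr; apply: eq_bigr => z _; rewrite scalerAl.
Qed.

Lemma inc_scalerAr a f g : a *: (f * g) = f * (a *: g).
Proof.
apply: incP => x y /=; have fin := cinterval_finite x y.
by rewrite !fsbig_finite//= scaler_sumr; apply: eq_bigr => z _; rewrite scalerAr.
Qed.

End IncidenceAlgebra.

Definition incL (T : comNzRingType) (R : algType T) (d : Order.disp_t)
    (X : lfPreorderType d) : set (incidence R X) :=
  [set f : incidence R X | forall x y : X, ~~ simeq x y -> f x y = 0].

Definition incM (T : comNzRingType) (R : algType T) (d : Order.disp_t)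
    (X : lfPreorderType d) : set (incidence R X) :=
  [set f : incidence R X | forall x y : X, simeq x y -> f x y = 0].

Arguments incL {T} R {d} X.
Arguments incM {T} R {d} X.

Lemma inc_idem_subproof (T : comNzRingType) (R : algType T) (d : Order.disp_t)
    (X : lfPreorderType d) (x s t : X) : ~~ (s <= t)%O ->
  (if (s == t) && simeq x s then 1 else 0 : R) = 0.
Proof. by case: (eqVneq s t) => [->|//]; rewrite lexx. Qed.

(* the idempotent e_x *)
Definition inc_idem (T : comNzRingType) (R : algType T) (d : Order.disp_t)
    (X : lfPreorderType d) (x : X) : incidence R X :=
  Incidence (@inc_idem_subproof T R d X x).

Arguments inc_idem {T} R {d X} x.

Section Isomorphisms.
Context {T : comNzRingType} {R : algType T} {d d' : Order.disp_t}
  {Y : lfPreorderType d} {X : lfPreorderType d'}.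

Definition algebra_iso (phi : incidence R Y -> incidence R X) : Prop :=
  [/\ linear phi, phi 1 = 1, {morph phi : f g / f * g} & bijective phi].

Definition diagonal_iso (gamma : incidence R Y -> incidence R X) : Prop :=
  [/\ algebra_iso gamma,
      gamma @` incL R Y `<=` incL R X & gamma @` incM R Y `<=` incM R X].

End Isomorphisms.

Definition condition_II (T : comNzRingType) (R : algType T)
    (d d' : Order.disp_t) (Y : lfPreorderType d) (X : lfPreorderType d') : Prop :=
  forall (phi : incidence R Y -> incidence R X)
         (phi_inv : incidence R X -> incidence R Y),
    algebra_iso phi -> cancel phi phi_inv -> cancel phi_inv phi ->
  forall x : X, exists y : Y,
    [set inc_idem R y + m | m in incM R Y] (phi_inv (inc_idem R x)).

Arguments condition_II {T} R {d d'} Y X.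

(* [u] is the inverse of [v] *)
Definition inner_automorphism (A : pzRingType) (nu : A -> A) : Prop :=
  exists v u : A, [/\ v * u = 1, u * v = 1 & forall a, nu a = u * a * v].

Lemma inner_automorphism_algebra_iso (T : comNzRingType) (R : algType T)
    (d : Order.disp_t) (X : lfPreorderType d)
    (nu : incidence R X -> incidence R X) :
  inner_automorphism nu -> algebra_iso nu.
Proof.
move=> [v [u [vu uv nuE]]]; split.
- by move=> a f g; rewrite !nuE mulrDr mulrDl -inc_scalerAr -inc_scalerAl.
- by rewrite nuE mulr1.
- by move=> f g; rewrite !nuE -!mulrA (mulrA v u) vu mul1r.
- exists (fun a => v * a * u) => a; rewrite nuE !mulrA.
    by rewrite vu mul1r -mulrA vu mulr1.
  by rewrite uv mul1r -mulrA uv mulr1.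
Qed.

(* Main.v *)
(** Put [g x = phi^-1 (e_x)], an orthogonal family of idempotents; Condition
    (II) gives [g x = f_(tau x)] modulo [M_1].  Since [1 + m] is invertible for
    [m] in [M_1] (its geometric series is finite on each interval), [tau]
    induces a bijection of classes, and the element [v] whose row [s] is the
    row [s] of the [g x] with [tau x ~ s] lies in [1 + M_1] and satisfies
    [v * g x = f_(tau x) * v].  Hence [gamma : a |-> phi (v^-1 * a * v)] maps
    each [f_(tau x)] to [e_x].  It is diagonal, because [L] is the commutant of
    the [e_x] and [M] is the set of [a] with [e_x * a * e_x = 0] for all [x]. *)
Require Import Defs.
From HB Require Import structures.
From mathcomp Require Import all_boot all_order all_algebra.
From mathcomp Require Import boolp classical_sets functions cardinality fsbigop.
From mathcomp Require Import finmap.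

Set Implicit Arguments.
Unset Strict Implicit.
Unset Printing Implicit Defensive.

Import Order.TTheory GRing.Theory.
Local Open Scope classical_set_scope.
Local Open Scope ring_scope.

(** * Equivalence classes of a preorder *)

Section ClassEquivalence.
Context {d : Order.disp_t} {X : preorderType d}.
Implicit Types x y z : X.

Lemma simeq_refl x : simeq x x.
Proof. by rewrite /simeq lexx. Qed.

Lemma simeq_sym x y : simeq x y = simeq y x.
Proof. by rewrite /simeq andbC. Qed.

Lemma simeq_trans y x z : simeq x y -> simeq y z -> simeq x z.
Proof.
move=> /andP[xy yx] /andP[yz zy].
by rewrite /simeq (le_trans xy yz) (le_trans zy yx).
Qed.

Lemma simeq_transl x y z : simeq x y -> simeq x z = simeq y z.
Proof.
move=> xy; apply/idP/idP; last exact: simeq_trans.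
by apply: simeq_trans; rewrite simeq_sym.
Qed.

(** An interval between equivalent points stays in one class; this is what makes [incM] an ideal. *)
Lemma simeq_cinterval x y z : simeq x y -> cinterval x y z -> simeq x z.
Proof.
by move=> /andP[_ yx] /andP[xz zy]; rewrite /simeq xz (le_trans zy yx).
Qed.

End ClassEquivalence.

(** * The idempotents e_x, and L and M in terms of them *)

Section IncidenceFacts.
Context {T : comNzRingType} {R : algType T} {d : Order.disp_t}
  {X : lfPreorderType d}.
Implicit Types (f g a b m u v : incidence R X) (x y z s t : X).

Lemma incD f g x y : (f + g) x y = f x y + g x y. Proof. by []. Qed.
Lemma incN f x y : (- f) x y = - f x y. Proof. by []. Qed.
Lemma incB f g x y : (f - g) x y = f x y - g x y. Proof. by []. Qed.
Lemma inc1 x y : (1 : incidence R X) x y = if x == y then 1 else 0.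
Proof. by []. Qed.
Lemma inc_mulE f g x y :
  (f * g) x y = \sum_(z \in cinterval x y) (f x z * g z y).
Proof. by []. Qed.

Lemma eq_inc_mul f f' g g' x y :
  (forall z, cinterval x y z -> f x z * g z y = f' x z * g' z y) ->
  (f * g) x y = (f' * g') x y.
Proof.
by move=> e; rewrite !inc_mulE; apply: eq_fsbigr => z /set_mem; exact: e.
Qed.

Lemma inc_idemE x s t :
  inc_idem R x s t = if (s == t) && simeq x s then 1 else 0.
Proof. by []. Qed.

Lemma inc_idemMl x a s t : (inc_idem R x * a) s t =
  if simeq x s then a s t else 0.
Proof.
case: ifP => xs.
  rewrite -[RHS](congr1 (fun f : incidence R X => f s t) (mul1r a)).
  by apply: eq_inc_mul => z _; rewrite inc_idemE inc1 xs andbT.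
rewrite inc_mulE; apply: fsbig1 => z _.
by rewrite inc_idemE xs andbF mul0r.
Qed.

Lemma inc_idemMr x a s t : (a * inc_idem R x) s t =
  if simeq x t then a s t else 0.
Proof.
case: ifP => xt.
  rewrite -[RHS](congr1 (fun f : incidence R X => f s t) (mulr1 a)).
  apply: eq_inc_mul => z _; rewrite inc_idemE inc1.
  by case: (eqVneq z t) => [->|//]; rewrite xt.
rewrite inc_mulE; apply: fsbig1 => z _; rewrite inc_idemE.
by case: (eqVneq z t) => [->|]; rewrite ?xt mulr0.
Qed.

Lemma inc_idem_eq x x' : simeq x x' -> inc_idem R x = inc_idem R x'.
Proof.
by move=> e; apply: incP => s t; rewrite !inc_idemE (simeq_transl _ e).
Qed.

Lemma inc_idemM x x' : inc_idem R x * inc_idem R x' =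
  if simeq x x' then inc_idem R x else 0.
Proof.
apply: incP => s t; rewrite inc_idemMl.
have [xs|nxs] := boolP (simeq x s); last first.
  by case: ifP => // _; rewrite inc_idemE (negbTE nxs) andbF.
rewrite inc_idemE (simeq_sym x') -(simeq_transl _ xs).
by case: (simeq x x'); rewrite ?andbF// inc_idemE xs.
Qed.

(** For the converse, compare the entries at [(s, t)] of both products with e_s: they are [a s t]
    and 0 when [s], [t] are not equivalent. *)
Lemma incL_commP a :
  incL R X a <-> forall x, inc_idem R x * a = a * inc_idem R x.
Proof.
split=> [La x|ca s t st].
  apply: incP => s t; rewrite inc_idemMl inc_idemMr.
  have [st|/La ->] := boolP (simeq s t); last by rewrite !if_same.
  by rewrite simeq_sym (simeq_transl _ st) simeq_sym.
have := congr1 (fun f : incidence R X => f s t) (ca s).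
by rewrite inc_idemMl inc_idemMr simeq_refl (negbTE st).
Qed.

Lemma incM_cornerP a :
  incM R X a <-> forall x, inc_idem R x * a * inc_idem R x = 0.
Proof.
split=> [Ma x|ca s t st].
  apply: incP => s t; rewrite inc_idemMr inc_idemMl.
  case: ifP => // xt; case: ifP => // xs.
  by apply: Ma; apply: simeq_trans xt; rewrite simeq_sym.
have := congr1 (fun f : incidence R X => f s t) (ca s).
by rewrite inc_idemMr inc_idemMl simeq_refl st.
Qed.

(** * M as an ideal; congruence modulo M *)

Lemma incM_D a b : incM R X a -> incM R X b -> incM R X (a + b).
Proof. by move=> Ma Mb x y xy; rewrite incD Ma ?Mb ?addr0. Qed.

Lemma incM_N a : incM R X a -> incM R X (- a).
Proof. by move=> Ma x y xy; rewrite incN Ma ?oppr0. Qed.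

Lemma incM_Ml a b : incM R X b -> incM R X (a * b).
Proof.
move=> Mb x y xy; rewrite inc_mulE; apply: fsbig1 => z xyz.
by rewrite Mb ?mulr0// -(simeq_transl _ (simeq_cinterval xy xyz)).
Qed.

Lemma incM_Mr a b : incM R X a -> incM R X (a * b).
Proof.
move=> Ma x y xy; rewrite inc_mulE; apply: fsbig1 => z xyz.
by rewrite Ma ?mul0r// (simeq_cinterval xy xyz).
Qed.

Lemma incM_congrM a a' b b' : incM R X (a - a') -> incM R X (b - b') ->
  incM R X (a * b - a' * b').
Proof.
move=> Ma Mb; have -> : a * b - a' * b' = (a - a') * b + a' * (b - b').
  by rewrite mulrBl mulrBr addrA subrK.
by apply: incM_D; [apply: incM_Mr|apply: incM_Ml].
Qed.

(** * Pointwise nilpotency of M and invertibility of 1 + M *)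

Let intsize s t := #|` fset_set (cinterval s t)|%fset.

Let intsize_mono s t z : cinterval s t z -> (intsize z t <= intsize s t)%N.
Proof.
move=> /andP[sz _]; apply: fsubset_leq_card.
have fin := @cinterval_finite d X; rewrite -fset_set_sub//.
by move=> w /andP[zw wt]; rewrite /cinterval/= wt (le_trans sz zw).
Qed.

Let intsize_mono_l s t z : cinterval s t z -> (intsize s z <= intsize s t)%N.
Proof.
move=> /andP[_ zt]; apply: fsubset_leq_card.
have fin := @cinterval_finite d X; rewrite -fset_set_sub//.
by move=> w /andP[sw wz]; rewrite /cinterval/= sw (le_trans wz zt).
Qed.

(** The point [s] is lost in passing to the interval from [z]. *)
Let intsize_lt s t z : cinterval s t z -> ~~ simeq s z ->
  (intsize z t < intsize s t)%N.
Proof.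
move=> /andP[sz zt] nsz; apply: fproper_ltn_card.
have fin := @cinterval_finite d X.
rewrite fproperE; apply/andP; split.
  rewrite -fset_set_sub// => w /andP[zw wt].
  by rewrite /cinterval/= wt (le_trans sz zw).
apply/negP; rewrite -fset_set_sub// => /(_ s).
rewrite /cinterval/= lexx (le_trans sz zt) => /(_ isT).
by case/andP => zs _; rewrite /simeq sz zs in nsz.
Qed.

(** A nonzero term of [m * m ^+ k] at [(s, t)] needs an intermediate [z] not equivalent to [s], and
    then the interval from [z] to [t] is strictly smaller. *)
Lemma incM_expr_eq0 m s t k : incM R X m -> (intsize s t <= k)%N ->
  (m ^+ k) s t = 0.
Proof.
move=> Mm; elim: k s t => [|k IHk] s t.
  (* An empty interval means that [s <= t] fails, so even [m ^+ 0 = 1] vanishes there. *)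
  rewrite leqn0 cardfs_eq0 => /eqP /(fset_set_set0 (cinterval_finite s t)) e.
  apply: incfunP; apply/negP => st.
  by have : cinterval s t s; [rewrite /cinterval/= lexx st|rewrite e].
move=> le; rewrite exprS inc_mulE; apply: fsbig1 => z stz.
have [sz|nsz] := boolP (simeq s z); first by rewrite Mm ?mul0r.
by rewrite IHk ?mulr0// -ltnS (leq_trans (intsize_lt stz nsz)).
Qed.

Let inc_geom_stable m s t n : incM R X m -> (intsize s t <= n)%N ->
  (\sum_(i < intsize s t) m ^+ i) s t = (\sum_(i < n) m ^+ i) s t.
Proof.
move=> Mm /subnKC <-; elim: (n - _)%N => [|k IHk]; first by rewrite addn0.
by rewrite addnS big_ord_recr incD -IHk incM_expr_eq0 ?addr0 ?leq_addr.
Qed.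

(** The inverse is the geometric series of [1 - v], cut off at each entry [(s, t)] after
    [intsize s t] terms, where it has become stationary. *)
Lemma incM_unit v : incM R X (v - 1) -> exists u, v * u = 1 /\ u * v = 1.
Proof.
move=> Mv; set m := 1 - v.
have Mm : incM R X m by rewrite /m -opprB; exact: incM_N.
have vE : v = 1 - m by rewrite /m opprB addrC subrK. clearbody m.
pose S n := \sum_(i < n) m ^+ i.
have vS n : v * S n = 1 - m ^+ n by rewrite vE -opprB mulNr -subrX1 opprB.
have Sv n : S n * v = 1 - m ^+ n.
  rewrite -vS; symmetry; apply: commr_sum => i _.
  by apply: commrX; rewrite vE /GRing.comm mulrBl [RHS]mulrBr mul1r mulr1.
have uP s t : ~~ (s <= t)%O -> S (intsize s t) s t = 0 by exact: incfunP.
exists (Incidence uP); split; apply: incP => s t.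
  (* Subintervals are no larger, so one truncation serves all the entries [u z t] of the product. *)
  transitivity ((v * S (intsize s t)) s t).
    apply: eq_inc_mul => z stz; congr (_ * _) => /=.
    by apply: inc_geom_stable => //; exact: intsize_mono.
  by rewrite vS incB incM_expr_eq0 ?subr0.
transitivity ((S (intsize s t) * v) s t).
  apply: eq_inc_mul => z stz; congr (_ * _) => /=.
  by apply: inc_geom_stable => //; exact: intsize_mono_l.
by rewrite Sv incB incM_expr_eq0 ?subr0.
Qed.

(** All positive powers of [p] equal [p], and high ones vanish at any given entry. *)
Lemma incM_idem_eq0 p : incM R X p -> p * p = p -> p = 0.
Proof.
move=> Mp pp; apply: incP => s t.
have pX k : p ^+ k.+1 = p by elim: k => // k IHk; rewrite exprS IHk.
by rewrite -(pX (intsize s t)) incM_expr_eq0.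
Qed.

End IncidenceFacts.

(** * Algebra isomorphisms and diagonality *)

Section CompositionOfIsomorphisms.
Context {T : comNzRingType} {R : algType T} {d1 d2 d3 : Order.disp_t}
  {X1 : lfPreorderType d1} {X2 : lfPreorderType d2} {X3 : lfPreorderType d3}.

Lemma algebra_iso_comp (f : incidence R X2 -> incidence R X3)
    (g : incidence R X1 -> incidence R X2) :
  algebra_iso f -> algebra_iso g -> algebra_iso (f \o g).
Proof.
move=> [fl f1 fM fbij] [gl g1 gM gbij]; split => /=.
- by move=> a x y /=; rewrite gl fl.
- by rewrite g1 f1.
- by move=> x y /=; rewrite gM fM.
- exact: bij_comp.
Qed.

Lemma algebra_iso0 (f : incidence R X1 -> incidence R X2) :
  algebra_iso f -> f 0 = 0.
Proof.
(* Linearity is applied to 0 written as [-1 *: 0 + 0]. *)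
by move=> [fl _ _ _]; rewrite -{1}(subrr 0) -scaleN1r addrC fl scaleN1r addNr.
Qed.

End CompositionOfIsomorphisms.

(** [incL_commP] and [incM_cornerP] describe L and M by equations in the idempotents, and [gamma]
    carries these equations over. *)
Lemma diagonal_iso_idem (T : comNzRingType) (R : algType T)
    (dY dX : Order.disp_t) (Y : lfPreorderType dY) (X : lfPreorderType dX)
    (gamma : incidence R Y -> incidence R X) (tau : X -> Y) :
  algebra_iso gamma ->
  (forall x, gamma (inc_idem R (tau x)) = inc_idem R x) -> diagonal_iso gamma.
Proof.
move=> gi ge; have [_ _ gM _] := gi; split => // _ [a aP <-].
  by apply/incL_commP => x; rewrite -ge -!gM; move/incL_commP: aP => ->.
apply/incM_cornerP => x; rewrite -ge -!gM.
by move/incM_cornerP: aP => ->; rewrite algebra_iso0.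
Qed.

(** * Orthogonal idempotents congruent to the f_y modulo M *)

Section IdempotentFamily.
Context {T : comNzRingType} {R : algType T} {dY dX : Order.disp_t}
  {Y : lfPreorderType dY} {X : lfPreorderType dX}.
Context (g : X -> incidence R Y) (tau : X -> Y).
Context (gM : forall x x', g x * g x' = if simeq x x' then g x else 0).
Context (g_eq : forall x x', simeq x x' -> g x = g x').
Context (gtau : forall x, incM R Y (g x - inc_idem R (tau x))).

(** Equality and orthogonality of the [g x] pass to the f_(tau x) modulo M; both directions are read
    off at the diagonal entry of [tau x], using 1 != 0 in [R]. *)
Lemma simeq_tau x x' : simeq (tau x) (tau x') = simeq x x'.
Proof.
have [xx'|nxx'] := boolP (simeq x x').
  have M0 : incM R Y (inc_idem R (tau x) - inc_idem R (tau x')).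
    rewrite -[X in incM _ _ X](subrKA (g x)) -opprB {2}(g_eq xx').
    by apply: incM_D => //; apply: incM_N.
  have := M0 _ _ (simeq_refl (tau x)); rewrite incB !inc_idemE eqxx simeq_refl /=.
  by rewrite simeq_sym; case: ifP => // _ /eqP; rewrite subr0 oner_eq0.
apply/negbTE/negP => txx'; move: (incM_congrM (gtau x) (gtau x')).
rewrite gM (negbTE nxx') sub0r inc_idemM txx' => /(_ _ _ (simeq_refl (tau x))).
rewrite incN inc_idemE eqxx simeq_refl => /eqP.
by rewrite oppr_eq0 oner_eq0.
Qed.

Lemma conj_idem_family : (forall y, exists x, simeq (tau x) y) ->
  exists u v : incidence R Y, [/\ v * u = 1, u * v = 1 &
    forall x, v * g x = inc_idem R (tau x) * v].
Proof.
move=> /choice [sigma sigmaP].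
have vP s t : ~~ (s <= t)%O -> g (sigma s) s t = 0 by exact: incfunP.
pose v := Incidence vP.
(* Within the class of [s], row [s] of f_(tau (sigma s)) is that of 1, so [v - 1] lies in M. *)
have [|u [vu uv]] := @incM_unit _ _ _ _ v.
  move=> s t st; have := gtau (sigma s) st.
  by rewrite !incB inc_idemE inc1 sigmaP andbT.
exists u, v; split=> // x; apply: incP => s t; rewrite inc_idemMl.
(* Row [s] of a product depends only on row [s] of its left factor. *)
have -> : (v * g x) s t = (g (sigma s) * g x) s t by exact: eq_inc_mul.
rewrite gM -simeq_tau (simeq_transl _ (sigmaP s)) simeq_sym.
by case: ifP.
Qed.

(* [g x] is conjugate to [inc_idem (tau x)], whose corner meets [incM] in 0. *)
Lemma idem_corner_incM x (h : incidence R Y) :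
  incM R Y (g x * h * g x) -> g x * h * g x = 0.
Proof.
set f := inc_idem R (tau x); set k := _ * _ * _ => Mk.
have ff : f * f = f by rewrite inc_idemM simeq_refl.
have gg : g x * g x = g x by rewrite gM simeq_refl.
(* The standard element intertwining two idempotents; it is 1 modulo M because [g x] is [f] modulo
   M. *)
have [|u [vu uv]] := @incM_unit _ _ _ _ (f * g x + (1 - f) * (1 - g x)).
  rewrite -[X in _ - X](_ : f * f + (1 - f) * (1 - f) = 1); last first.
    by rewrite mulrBl mul1r mulrBr mulr1 ff subrr subr0 addrC subrK.
  rewrite opprD addrACA -!mulrBr; apply: incM_D; apply: incM_Ml => //.
  by rewrite opprB addrC addrA subrK -opprB; exact: incM_N.
set v := _ + _ in vu uv.
have vg : v * g x = f * v.
  have g0 : (1 - g x) * g x = 0 by rewrite mulrBl mul1r gg subrr.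
  have f0 : f * (1 - f) = 0 by rewrite mulrBr mulr1 ff subrr.
  rewrite /v mulrDl [RHS]mulrDr -!mulrA gg g0 mulr0 addr0.
  by rewrite (mulrA f (1 - f)) f0 mul0r addr0 mulrA ff.
have gu : g x * u = u * f.
  by rewrite -[LHS]mul1r -uv -!mulrA (mulrA v) vg -!mulrA vu mulr1.
have kE : v * k * u = f * (v * k * u) * f.
  by rewrite /k !mulrA -vg -!mulrA -gu 2!(mulrA (g x) (g x)) gg.
have M0 : incM R Y (v * k * u) by apply/incM_Mr/incM_Ml.
(* The conjugate of [k] lies both in M and in the corner of [f]. *)
have k0 : v * k * u = 0 by rewrite kE; move/incM_cornerP: M0; apply.
have -> : k = u * (v * k * u) * v by rewrite !mulrA uv mul1r -mulrA uv mulr1.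
by rewrite k0 mulr0 mul0r.
Qed.

End IdempotentFamily.

(** * The factorization of an isomorphism *)

Theorem theorem13p2 (T : comNzRingType) (R : algType T) (dY dX : Order.disp_t)
    (Y : lfPreorderType dY) (X : lfPreorderType dX)
    (hII : condition_II R Y X)
    (phi : incidence R Y -> incidence R X) (hphi : algebra_iso phi) :
  exists (nu : incidence R X -> incidence R X)
         (gamma : incidence R Y -> incidence R X),
    [/\ inner_automorphism nu, diagonal_iso gamma & phi = nu \o gamma].
Proof.
have [philin phi1 phiM [psi phiK psiK]] := hphi.
have psiM : {morph psi : a b / a * b}.
  by move=> a b; apply: (can_inj phiK); rewrite phiM !psiK.
have phi0 := algebra_iso0 hphi.
have psi0 : psi 0 = 0 by rewrite -phi0 phiK.
pose g x := psi (inc_idem R x).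
have [tau tauP] := choice (hII phi psi hphi phiK psiK).
have gtau x : incM R Y (g x - inc_idem R (tau x)).
  by have [m Mm] := tauP x; rewrite /g => <-; rewrite addrC addKr.
have gM x x' : g x * g x' = if simeq x x' then g x else 0.
  by rewrite /g -psiM inc_idemM; case: ifP; rewrite ?psi0.
have g_eq x x' : simeq x x' -> g x = g x'.
  by move=> e; rewrite /g (inc_idem_eq e).
(* If [tau] missed the class of [y], then [f] would be orthogonal to every f_(tau x). So each
   [g x * f * g x] would lie in M, hence be 0, and [phi f] would be an idempotent of M, that is
   0. *)
have tau_surj y : exists x, simeq (tau x) y.
  apply: contrapT => ntau; set f := inc_idem R y.
  suff f0 : f = 0.
    have := congr1 (fun a : incidence R Y => a y y) f0.
    by rewrite inc_idemE eqxx simeq_refl => /eqP; rewrite oner_eq0.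
  rewrite -[LHS]phiK -[RHS]psi0; congr psi.
  apply: incM_idem_eq0; last by rewrite -phiM inc_idemM simeq_refl.
  apply/incM_cornerP => x; rewrite -[inc_idem R x]psiK -/(g x) -!phiM -[RHS]phi0.
  congr phi; apply: (idem_corner_incM gM gtau).
  apply: incM_Mr; rewrite -[X in incM _ _ X]subr0.
  have <- : inc_idem R (tau x) * f = 0.
    by rewrite inc_idemM; case: ifP => // tx; case: ntau; exists x.
  by apply: incM_congrM => //; rewrite subrr.
have [u [v [vu uv vg]]] := conj_idem_family gM g_eq gtau tau_surj.
pose gamma a := phi (u * a * v).
have gi : algebra_iso gamma.
  apply: (@algebra_iso_comp _ _ _ _ _ _ _ _ phi) => //.
  by apply: inner_automorphism_algebra_iso; exists v, u.
(* Conjugation by [gamma u], which equals [phi u] since [u * v = 1], undoes the twist in [gamma]. *)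
exists (fun a => gamma v * a * gamma u), gamma; have [_ g1 gMM _] := gi; split.
- by exists (gamma u), (gamma v); split => //; rewrite -gMM ?vu ?uv.
- apply: (diagonal_iso_idem gi (tau := tau)) => x.
  by rewrite /gamma -mulrA -vg mulrA uv mul1r psiK.
- apply/funext => a /=; rewrite -!gMM /gamma; congr phi.
  by rewrite !mulrA uv mul1r -!mulrA uv mulr1.
Qed.
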